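(* Let $n\ge3$ and $t\ge0$ be integers, and let $\mathcal{T}$ be the conjugacy class of transpositions of $\mathfrak{S}_n$. Define $$M_1^{(n)}(t)=\frac12\sum_{\sigma\in\mathfrak{E}(\mathcal{T},t)}\left|\sum_{\lambda\in\{(n-1,1),\,(2,1^{n-2})\}}\frac{d_\lambda}{n!}\chi^\lambda(\mathcal{T})^t\,\mathrm{ch}^\lambda(\sigma)\right|.$$ Then $$\left|M_1^{(n)}(t)-\frac{n-1}{e}\left(\frac{n-3}{n-1}\right)^t\right|\le\frac1{(n-2)!}.$$
   Context: For $\lambda\vdash n$, $\mathrm{ch}^\lambda$ is the irreducible character of $\mathfrak{S}_n$, $d_\lambda$ its dimension and $\chi^\lambda=\mathrm{ch}^\lambda/d_\lambda$; $\chi^\lambda(\mathcal{T})$ is its value at a transposition. $\mathfrak{E}(\mathcal{T},t)=\mathfrak{S}_n\setminus\mathfrak{A}_n$ if $t$ is odd and $\mathfrak{A}_n$ (the alternating group) if $t$ is even. The convention $0^0=1$ is used. *)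

(* Defs.v *)
From HB Require Import structures.
From mathcomp Require Import all_boot all_order all_algebra all_fingroup.
From mathcomp Require Import all_classical all_reals all_analysis.
Set Implicit Arguments. Unset Strict Implicit. Unset Printing Implicit Defensive.
Import Order.TTheory GRing.Theory Num.Theory.
Local Open Scope ring_scope.

(* Irreducible character of S_n for lambda = (n-1,1): the standard character,
   ch(sigma) = #fixed points of sigma - 1. *)
Definition ch_std (R : realType) (n : nat) (s : 'S_n) : R :=
  (#|[set i | s i == i]|)%:R - 1.

(* Irreducible character for lambda = (2,1^{n-2}) = sign (x) standard. *)
Definition ch_alt (R : realType) (n : nat) (s : 'S_n) : R :=
  (-1) ^+ (odd_perm s) * ch_std R s.

Definition dimch (R : realType) (n : nat) (ch : 'S_n -> R) : R := ch 1%g.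
Definition chi_norm (R : realType) (n : nat) (ch : 'S_n -> R) (s : 'S_n) : R :=
  ch s / dimch ch.

(* A representative transposition (0 1) of the class T (n >= 2). *)
Definition transp0 (n : nat) : 'S_n :=
  match n return 'S_n with
  | n'.+2 => tperm (ord0 : 'I_n'.+2) (lift ord0 (ord0 : 'I_n'.+1))
  | _ => 1%g
  end.

(* The set E(T,t): odd permutations if t odd, even ones if t even. *)
Definition inE_T (n t : nat) (s : 'S_n) : bool := odd_perm s == odd t.

Definition M1 (R : realType) (n t : nat) : R :=
  2^-1 * \sum_(s : 'S_n | inE_T t s)
    `| \sum_(ch <- [:: ch_std R (n:=n); ch_alt R (n:=n)])
         (dimch ch / (n`!)%:R * (chi_norm ch (transp0 n)) ^+ t * ch s) |.

(* Main.v *)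
Require Import Defs.
From HB Require Import structures.
From mathcomp Require Import all_boot all_order all_algebra all_fingroup.
From mathcomp Require Import all_classical all_reals all_analysis.
(* Re-imported so that [set0], [setT], [subsetP] are the finite-set notions
   rather than those of classical_sets. *)
From mathcomp Require Import fintype finset.
From mathcomp Require Import ring lra zify.

(* For sigma of the parity prescribed by t, sign(sigma) = (-1)^t, so both
   characters contribute equally and
     M_1 = (n-1)/n! * ((n-3)/(n-1))^t * sum_{sigma in E} |fix(sigma) - 1|.
   As |fix - 1| = (fix - 1) + 2 [sigma is a derangement] and the standard
   character is orthogonal to 1 and to the sign, this sum only involves the
   derangements of each parity, which inclusion-exclusion counts:
   D_n = n! sum_{k<=n} (-1)^k/k! and D_n^even - D_n^odd = (-1)^(n+1) (n-1).
   The bound then follows from |sum_{k<=n} (-1)^k/k! - 1/e| <= 1/n! and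
   (n-1) n / n! = 1/(n-2)!. *)

Set Implicit Arguments.
Unset Strict Implicit.
Unset Printing Implicit Defensive.

Import Order.TTheory GRing.Theory Num.Theory.
Local Open Scope ring_scope.

Section SubsetSums.
Variable T : finType.

Lemma sum_subsets_by_card (V : nmodType) (F : {set T}) (f : nat -> V) :
  \sum_(K : {set T} | K \subset F) f #|K| = \sum_(k < #|F|.+1) f k *+ 'C(#|F|, k).
Proof.
rewrite (partition_big (fun K : {set T} => inord #|K| : 'I_#|F|.+1) predT) //=.
apply: eq_bigr => k _; rewrite -(cards_draws F k) -sumr_const.
have cardK (K : {set T}) : K \subset F -> (inord #|K| == k :> 'I_#|F|.+1) = (#|K| == k).
  by move=> sKF; rewrite -val_eqE /= inordK // ltnS subset_leq_card.
apply: eq_big => [K | K /andP[sKF]]; last by rewrite cardK // => /eqP->.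
by rewrite inE; case: (boolP (K \subset F)) => //= /cardK.
Qed.

Lemma sum_sign_subsets (R : comRingType) (F : {set T}) :
  \sum_(K : {set T} | K \subset F) (-1) ^+ #|K| = (F == set0)%:R :> R.
Proof.
rewrite (sum_subsets_by_card F (fun k => (-1) ^+ k : R)).
have := exprBn (1 : R) 1 #|F|; rewrite subrr expr0n cards_eq0 => ->.
by apply: eq_bigr => k _; rewrite !expr1n !mulr1.
Qed.

Lemma sum_sieve (R : comRingType) (I : finType) (F : I -> {set T}) (w : I -> R) :
  \sum_(i | F i == set0) w i =
  \sum_(K : {set T}) (-1) ^+ #|K| * \sum_(i | K \subset F i) w i.
Proof.
rewrite big_mkcond; under eq_bigr do rewrite -mulrb -mulr_natr -sum_sign_subsets mulr_sumr.
rewrite (exchange_big_dep predT) //=; apply: eq_bigr => K _.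
by rewrite mulr_sumr; apply: eq_bigr => i _; rewrite mulrC.
Qed.

End SubsetSums.

Lemma sum_sign_perm_on (R : numDomainType) (T : finType) (B : {set T}) :
  \sum_(s : {perm T} | perm_on B s) (-1) ^+ odd_perm s = (#|B| <= 1)%:R :> R.
Proof.
have [B_le1 | /card_gt1P[x [y [xB yB xy]]]] := leqP #|B| 1.
  rewrite (bigD1 1%g) ?perm_on1 //= big1 ?addr0 ?odd_perm1 // => s /andP[sB].
  by rewrite (perm_on_id sB B_le1) eqxx.
have txyB : perm_on B (tperm x y).
  by apply: subset_trans (tperm_on x y) _; rewrite subUset !sub1set xB yB.
set S := \sum_(s | _) _; suff: S *+ 2 = 0 by move/eqP; rewrite mulrn_eq0 => /eqP.
rewrite mulr2n; apply/eqP; rewrite addr_eq0 {1}/S (reindex_inj (mulgI (tperm x y))) /= -sumrN.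
apply/eqP/eq_big => [s | s _]; last by rewrite odd_mul_tperm xy signrN.
apply/idP/idP => [|sB]; last exact: perm_onM.
by move/(perm_onM txyB); rewrite mulgA tperm2 mul1g.
Qed.

Definition fixset {n} (s : 'S_n) : {set 'I_n} := [set i | s i == i].

Definition derangement {n} (s : 'S_n) : bool := fixset s == set0.

Section FixingPermutations.
Variables (n : nat) (K : {set 'I_n}).

Lemma sub_fixsetE (s : 'S_n) : (K \subset fixset s) = perm_on (~: K) s.
Proof.
apply/subsetP/subsetP => sKs i.
  by rewrite !inE; apply: contra => /sKs; rewrite inE.
by rewrite inE => iK; apply: contraTT iK => /sKs; rewrite inE.
Qed.

Lemma card_perm_fixing : #|[set s : 'S_n | K \subset fixset s]| = (n - #|K|)`!.
Proof.
have -> : (n - #|K|)%N = #|~: K| by rewrite [RHS]cardsCs setCK card_ord.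
rewrite -card_perm.
by apply: eq_card => s; rewrite inE sub_fixsetE.
Qed.

Lemma sum_perm_fixing (R : nmodType) (x : R) :
  \sum_(s : 'S_n | K \subset fixset s) x = x *+ (n - #|K|)`!.
Proof. by rewrite -card_perm_fixing -sumr_const; apply: eq_bigl => s; rewrite inE. Qed.

Lemma sum_sign_perm_fixing (R : numDomainType) :
  \sum_(s : 'S_n | K \subset fixset s) (-1) ^+ odd_perm s = (n - #|K| <= 1)%:R :> R.
Proof.
have -> : (n - #|K|)%N = #|~: K| by rewrite [RHS]cardsCs setCK card_ord.
rewrite -sum_sign_perm_on.
by apply: eq_bigl => s; rewrite sub_fixsetE.
Qed.

End FixingPermutations.

Lemma sum1_derangements (R : numFieldType) n :
  \sum_(s : 'S_n | derangement s) 1 = n`!%:R * \sum_(k < n.+1) (-1) ^+ k / k`!%:R :> R.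
Proof.
rewrite sum_sieve; under eq_bigr do rewrite sum_perm_fixing.
rewrite (eq_bigl (fun K : {set 'I_n} => K \subset setT)) => [|K]; last by rewrite subsetT.
rewrite (sum_subsets_by_card setT (fun k => (-1) ^+ k * (n - k)`!%:R : R)).
rewrite cardsT card_ord mulr_sumr; apply: eq_bigr => k _.
have kn : (k <= n)%N by rewrite -ltnS.
rewrite -mulr_natr -(bin_fact kn) !natrM; field.
by rewrite pnatr_eq0 -lt0n fact_gt0.
Qed.

Lemma sum_sign_derangements (R : numDomainType) n :
  \sum_(s : 'S_n | derangement s) (-1) ^+ odd_perm s = (-1) ^+ n.+1 * (n%:R - 1) :> R.
Proof.
rewrite sum_sieve; under eq_bigr do rewrite sum_sign_perm_fixing.
rewrite (eq_bigl (fun K : {set 'I_n} => K \subset setT)) => [|K]; last by rewrite subsetT.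
rewrite (sum_subsets_by_card setT (fun k => (-1) ^+ k * (n - k <= 1)%:R : R)).
rewrite cardsT card_ord; case: n => [|n].
  by rewrite big_ord1 expr0 mul1r mulr1n mulN1r sub0r opprK.
rewrite 2!big_ord_recr big1 /= => [|k _]; last first.
  have kn := ltn_ord k.
  by rewrite (_ : (n.+1 - k <= 1)%N = false) ?mulr0 ?mul0rn //; lia.
rewrite subSnn subnn binSn binn add0r /= !mulr1 mulr1n -mulr_natr !exprS.
ring.
Qed.

Lemma sum_perm_parity (R : numFieldType) (T : finType) (b : bool) (g : {perm T} -> R) :
  \sum_(s : {perm T} | odd_perm s == b) g s =
  2^-1 * (\sum_(s : {perm T}) g s + (-1) ^+ b * \sum_(s : {perm T}) (-1) ^+ odd_perm s * g s).
Proof.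
rewrite big_mkcond mulr_sumr -big_split mulr_sumr; apply: eq_bigr => s _.
have two0 : (2 : R) != 0 by rewrite pnatr_eq0.
by case: (odd_perm s); case: b => /=; field.
Qed.

Section StandardCharacter.
Variable R : realType.

Lemma sum_mul_ch_std n (w : 'S_n -> R) :
  \sum_s w s * ch_std R s =
  \sum_(i : 'I_n) \sum_(s | [set i] \subset fixset s) w s - \sum_s w s.
Proof.
under eq_bigr do rewrite mulrBr mulr1 -sum1_card natr_sum mulr_sumr.
rewrite sumrB (exchange_big_dep predT) //=.
by congr (_ - _); apply: eq_bigr => i _; apply: eq_big => [s | s _]; rewrite ?sub1set ?mulr1.
Qed.

Lemma sum_ch_std n : (0 < n)%N -> \sum_(s : 'S_n) ch_std R s = 0.
Proof.
case: n => // n _; under eq_bigr do rewrite -[ch_std R _]mul1r.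
rewrite sum_mul_ch_std; under eq_bigr do rewrite sum_perm_fixing cards1.
rewrite !sumr_const -[#|xpredT|]/#|'I_n.+1| card_ord card_Sn.
by rewrite subn1 -mulrnA mulnC -factS subrr.
Qed.

Lemma sum_sign_ch_std n : (2 < n)%N ->
  \sum_(s : 'S_n) (-1) ^+ odd_perm s * ch_std R s = 0.
Proof.
move=> n_gt2; rewrite sum_mul_ch_std (eq_bigl (fun s => set0 \subset fixset s)) => [|s]; last by rewrite sub0set.
rewrite sum_sign_perm_fixing cards0 subn0 (_ : (n <= 1)%N = false) ?subr0; last by lia.
by rewrite big1 // => i _; rewrite sum_sign_perm_fixing cards1 (_ : (n - 1 <= 1)%N = false) //; lia.
Qed.

Lemma norm_ch_std n (s : 'S_n) : `|ch_std R s| = ch_std R s + 2 * (derangement s)%:R.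
Proof.
rewrite /ch_std /derangement -cards_eq0; case: #|_| => [|k] /=.
  by rewrite sub0r normrN normr1; lra.
by rewrite -natr1 addrK normr_nat mulr0 addr0.
Qed.

Lemma sum_mul_norm_ch_std n (w : 'S_n -> R) :
  \sum_s w s * `|ch_std R s| =
  \sum_s w s * ch_std R s + 2 * \sum_(s | derangement s) w s.
Proof.
rewrite mulr_sumr [X in _ + X]big_mkcond -big_split; apply: eq_bigr => s _.
by rewrite norm_ch_std mulrDr; case: (derangement s); rewrite /= ?mulr1 ?mulr0 // [2 * _]mulrC.
Qed.

Lemma sum_norm_ch_std n b : (2 < n)%N ->
  \sum_(s : 'S_n | odd_perm s == b) `|ch_std R s| =
  \sum_(s : 'S_n | derangement s) 1
  + (-1) ^+ b * \sum_(s : 'S_n | derangement s) (-1) ^+ odd_perm s.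
Proof.
move=> n_gt2; rewrite sum_perm_parity.
rewrite -(eq_bigr _ (fun s _ => mul1r `|ch_std R s|)) !sum_mul_norm_ch_std.
rewrite (eq_bigr _ (fun s _ => mul1r (ch_std R s))) sum_ch_std; last by lia.
rewrite sum_sign_ch_std // !add0r mulrCA -mulrDr mulKf // pnatr_eq0.
Qed.

Lemma dimch_std n : dimch (ch_std R (n:=n)) = n%:R - 1.
Proof.
rewrite /dimch /ch_std (_ : [set i | _] = setT) ?cardsT ?card_ord //.
by apply/setP => i; rewrite !inE perm1 eqxx.
Qed.

Lemma dimch_alt n : dimch (ch_alt R (n:=n)) = n%:R - 1.
Proof. by rewrite /dimch /ch_alt odd_perm1 mul1r; exact: dimch_std. Qed.

Lemma odd_transp0 n : (1 < n)%N -> odd_perm (transp0 n).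
Proof. by case: n => [|[|n]] // _; rewrite odd_tperm. Qed.

Lemma ch_std_transp0 n : (1 < n)%N -> ch_std R (transp0 n) = n%:R - 3.
Proof.
case: n => [|[|n]] // _; rewrite /ch_std /transp0.
set x := ord0; set y := lift x ord0.
have -> : [set i | tperm x y i == i] = ~: [set x; y].
  apply/setP => i; rewrite !inE; case: tpermP => [->|->|/eqP/negbTE-> /eqP/negbTE->] //.
  by rewrite eqxx.
rewrite [#|_|]cardsCs setCK card_ord cards2 /= !subSS subn0.
ring.
Qed.

Lemma M1E n t : (2 < n)%N ->
  M1 R n t = (n%:R - 1) / n`!%:R * ((n%:R - 3) / (n%:R - 1)) ^+ t
             * \sum_(s : 'S_n | inE_T t s) `|ch_std R s|.
Proof.
move=> n_gt2; set a := (n%:R - 3) / (n%:R - 1); set c := _ * a ^+ t.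
have c_ge0 : 0 <= c.
  have n_ge3 : (3 : R) <= n%:R by rewrite ler_nat.
  by rewrite mulr_ge0 ?exprn_ge0 ?divr_ge0 //; lra.
rewrite /M1 (eq_bigr (fun s : 'S_n => 2 * (c * `|ch_std R s|))) => [|s /eqP odd_s].
  by rewrite -!mulr_sumr mulKf // pnatr_eq0.
rewrite !big_cons big_nil addr0 /chi_norm dimch_std dimch_alt /ch_alt.
rewrite odd_transp0 ?ch_std_transp0 ?odd_s; try lia.
rewrite -[X in `|X|](_ : 2 * c * ch_std R s = _); last first.
  rewrite [(-1) ^+ true]expr1 mulN1r mulNr -/a (exprNn a) -signr_odd /c.
  by case: (odd t); rewrite ?expr0 ?expr1; ring.
by rewrite -mulrA normrM normrM (ger0_norm c_ge0) normr_nat.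
Qed.

Lemma M1_closed_form n t : (2 < n)%N ->
  M1 R n t = (n%:R - 1) * ((n%:R - 3) / (n%:R - 1)) ^+ t *
    (\sum_(k < n.+1) (-1) ^+ k / k`!%:R + (-1) ^+ (t + n.+1) * (n%:R - 1) / n`!%:R).
Proof.
move=> n_gt2; rewrite M1E // sum_norm_ch_std // sum1_derangements.
rewrite sum_sign_derangements signr_odd exprD.
by field; rewrite pnatr_eq0 -lt0n fact_gt0.
Qed.

End StandardCharacter.

Lemma sum_inv_fact_tail (R : realFieldType) n m : (0 < n)%N ->
  \sum_(n <= k < m) (k.+1`!%:R : R)^-1 <= n`!%:R^-1.
Proof.
move=> n_gt0; have [mn | nm] := leqP m n; first by rewrite big_geq // invr_ge0 ler0n.
have half_step k : (n <= k)%N -> (k.+1`!%:R : R)^-1 <= k`!%:R^-1 - k.+1`!%:R^-1.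
  move=> nk; rewrite factS natrM invfM.
  set x := (k`!%:R : R)^-1; set z := (k.+1%:R : R)^-1.
  have z_le : z <= 2^-1 by rewrite lef_pV2 ?posrE ?ltr0n // ler_nat ltnS (leq_trans n_gt0).
  have x_ge0 : 0 <= x by rewrite invr_ge0 ler0n.
  have := ler_wpM2r x_ge0 z_le; lra.
apply: le_trans (ler_sum_nat _) _ => [k /andP[nk _] | ]; first exact: half_step.
under eq_bigr do rewrite -opprB.
by rewrite sumrN telescope_sumr 1?ltnW // opprB gerBl invr_ge0 ler0n.
Qed.

Lemma expRN1_partial_sum (R : realType) n : (0 < n)%N ->
  `|\sum_(k < n.+1) (-1) ^+ k / k`!%:R - expR (-1)| <= n`!%:R^-1 :> R.
Proof.
move=> n_gt0; set c := \sum_(k < n.+1) _.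
suff : closed_ball_ Num.norm c (n`!%:R^-1) (expR (-1)) by [].
apply: (closed_cvg _ (@closed_closed_ball_ _ _ c _) _ _ (is_cvg_series_exp_coeff _)).
near=> m; have nm : (n < m)%N by near: m; exact: nbhs_infty_gt.
rewrite /closed_ball_ /= seriesEnat /= (big_cat_nat (leq0n n.+1) nm) big_mkord /=.
rewrite -/c opprD addNKr normrN; apply: le_trans (ler_norm_sum _ _ _) _.
rewrite big_add1 /=; apply: (le_trans _ (sum_inv_fact_tail R m.-1 n_gt0)).
apply: ler_sum_nat => k _.
by rewrite /exp_coeff /= normrM normrX normrN normr1 expr1n mul1r normfV normr_nat.
Unshelve. all: by end_near.
Qed.

Lemma invf_fact_subn2 (R : numFieldType) n : (1 < n)%N ->
  ((n - 2)`!%:R)^-1 = (n%:R - 1) * n%:R / n`!%:R :> R.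
Proof.
case: n => [|[|n]] // _; rewrite subSS subSS subn0 !factS !natrM.
by field; rewrite nat1r -natrD !pnatr_eq0 -lt0n fact_gt0.
Qed.

Theorem lemma5p5 (R : realType) (n t : nat) (hn : (3 <= n)%N) :
  `| M1 R n t - (n - 1)%:R / expR 1 * ((n - 3)%:R / (n - 1)%:R) ^+ t |
    <= ((n - 2)`!)%:R^-1.
Proof.
rewrite M1_closed_form // !natrB ?(leq_trans _ hn) // -expRN.
set d : R := n%:R - 1; set A := _ ^+ t; set p : R := n`!%:R.
set E := \sum_(k < n.+1) _; set eps : R := (-1) ^+ (t + n.+1).
have p_gt0 : 0 < p by rewrite ltr0n fact_gt0.
have d_ge0 : 0 <= d by rewrite subr_ge0 ler1n ltnW // ltnW.
have /andP[A_ge0 A_le1] : 0 <= A <= 1.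
  have a_ge0 : 0 <= (n%:R - 3) / d by rewrite divr_ge0 // subr_ge0 ler_nat.
  rewrite exprn_ge0 // exprn_ile1 // ler_pdivrMr ?mul1r ?lerD2l ?lerN2 ?ler1n //.
  by rewrite subr_gt0 ltr1n ltnW.
have X_le : `|E - expR (-1) + eps * d / p| <= (1 + d) / p.
  apply: le_trans (ler_normD _ _) _.
  rewrite mulrDl mul1r lerD //; first exact: expRN1_partial_sum (ltnW (ltnW hn)).
  by rewrite !normrM normfV normrX normrN normr1 expr1n mul1r ger0_norm ?gtr0_norm.
rewrite (_ : _ - _ = d * A * (E - expR (-1) + eps * d / p)); last by ring.
rewrite invf_fact_subn2 1?ltnW // -/d -/p (_ : n%:R = 1 + d); last by rewrite /d addrC subrK.
rewrite normrM (ger0_norm (mulr_ge0 d_ge0 A_ge0)) -[d * A * _]mulrA.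
rewrite -[d * (1 + d) / p]mulrA ler_wpM2l //.
by apply: le_trans X_le; rewrite ler_piMl.
Qed.
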